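(* Consider three distinct lines $(P_1P_4)$, $(P_2P_5)$, $(P_3P_6)$ on the real (resp. complex) projective plane that intersect at a common point $C$, where the points $P_i$ are generically chosen on the corresponding lines. Set $A=(P_1P_2)\cap(P_5P_6)$, $B=(P_2P_3)\cap(P_4P_5)$, $A'=(AC)\cap(P_3P_4)$, $B'=(BC)\cap(P_1P_6)$. Then the lines $(AB')$, $(A'B)$, $(P_2P_5)$ are concurrent.
   Context: $(XY)$ denotes the line through two distinct points $X,Y$. Lines are concurrent if they have a common point. ''Generic'' choices are choices belonging to a suitable Zariski dense subset of the appropriate configuration space; concretely, the assertion is that the conclusion holds for all choices in some nonempty Zariski open subset of the space of choices. *)

(* Defs.v *)
From HB Require Import structures.
From mathcomp Require Import all_boot all_order all_algebra.
From mathcomp Require Import reals.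
From mathcomp Require Import mpoly complex.

Set Implicit Arguments.
Unset Strict Implicit.
Unset Printing Implicit Defensive.

Import GRing.Theory.
Local Open Scope ring_scope.

(* The projective plane over K: its points (resp. lines) are the subspaces of
   K^3 of dimension 1 (resp. 2), so that incidence is inclusion [(p <= l)%VS],
   the line through two distinct points is their sum [(p + q)%VS] and the
   intersection point of two distinct lines is [(l :&: m)%VS]. *)
Definition ppoint (K : fieldType) := {p : {vspace 'rV[K]_3} | \dim p == 1%N}.
Definition pline (K : fieldType) := {l : {vspace 'rV[K]_3} | \dim l == 2%N}.

Definition subspace_of_ppoint (K : fieldType) (p : ppoint K) :
  {vspace 'rV[K]_3} := val p.
Coercion subspace_of_ppoint : ppoint >-> space.

Definition subspace_of_pline (K : fieldType) (l : pline K) :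
  {vspace 'rV[K]_3} := val l.
Coercion subspace_of_pline : pline >-> space.

Definition line_through (K : fieldType) (p q : ppoint K) (l : pline K) : Prop :=
  p <> q /\ (p + q)%VS = l.

(* x = (pq) \cap (rs), including that the right-hand side is well defined. *)
Definition meet_of_lines (K : fieldType) (p q r s x : ppoint K) : Prop :=
  exists l m : pline K,
    [/\ line_through p q l, line_through r s m, l <> m & (l :&: m)%VS = x].

Definition concurrent (K : fieldType) (l m n : pline K) : Prop :=
  exists x : ppoint K, [/\ (x <= l)%VS, (x <= m)%VS & (x <= n)%VS].

(* A matrix whose i-th row is a system of homogeneous coordinates of P i. *)
Definition hcoords (K : fieldType) (n : nat) (P : 'I_n -> ppoint K)
  (v : 'M[K]_(n, 3)) : Prop := forall i, <[row i v]>%VS = P i.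

(* Homogeneous in each of the n blocks of 3 variables separately; the variable
   of index [mxvec_index i j] stands for the j-th coordinate of the i-th point. *)
Definition multihomogeneous (K : fieldType) (n : nat) (f : {mpoly K[n * 3]}) :
    Prop :=
  exists d : 'I_n -> nat, forall m, m \in msupp f ->
    forall i, (\sum_(j < 3) m (mxvec_index i j))%N = d i.

(* Union of the non-vanishing loci of the members of S; by multihomogeneity,
   f <> 0 at P does not depend on the choice of the coordinates v of P. *)
Definition zariski_open (K : fieldType) (n : nat)
    (U : ('I_n -> ppoint K) -> Prop) : Prop :=
  exists S : {mpoly K[n * 3]} -> Prop,
    (forall f, S f -> multihomogeneous f) /\
    (forall P, U P <-> exists f v, [/\ S f, hcoords P v & f.@[mxvec v 0] != 0]).

(* Q holds on a nonempty open subset of X for the subspace topology on X. *)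
Definition generically (K : fieldType) (n : nat)
    (X Q : ('I_n -> ppoint K) -> Prop) : Prop :=
  exists U : ('I_n -> ppoint K) -> Prop,
    [/\ zariski_open U, exists P, X P /\ U P & forall P, X P -> U P -> Q P].

(* Main.v *)
Require Import Defs.
From HB Require Import structures.
From mathcomp Require Import all_boot all_order all_algebra.
From mathcomp Require Import reals.
From mathcomp Require Import mpoly complex.
From mathcomp Require Import ring.

Set Implicit Arguments.
Unset Strict Implicit.
Unset Printing Implicit Defensive.

Import GRing.Theory.
Local Open Scope ring_scope.

(** The three lines through C admit a common frame (a, b, c) of K^3: c spans C,
    the lines are <a, c>, <b, c> and <a + b, c> ([concurrent_lines_frame]).
    A point other than C on one of them is then spanned by u + x c, where u is
    a, b or a + b and x is a scalar, called here its slope. Write x1, ..., x6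
    for the slopes of P1, ..., P6 and put p = x5 - x2, q = x1 + x5 - x6,
    q' = x2 + x4 - x3. Solving the linear systems gives, modulo c,

      A = A' = p a + q b   and   B = B' = - p a + q' b,

    so that both A + B' and A' + B have no a-component and the same b-component
    q + q': they are points of (P2P5). Their c-components also agree, because
    their difference is q q' - q' q. Hence A + B' = A' + B is a vector of all
    three lines ([hexagon_concurrent]).

    Everything above is well defined as soon as no P_i is C, P2 differs from P5
    (that is, p <> 0, which is part of the choice of the line (P2P5)) and
    q + q' = x1 + x2 - x3 + x4 + x5 - x6 is nonzero. This last condition and
    P_i <> C together form the nonvanishing of one multihomogeneous polynomial:
    if phi_i and gamma are the linear forms reading the u- and c-coordinates,
    the slope of P_i is gamma / phi_i, and clearing the denominators in the
    signed sum of slopes, then multiplying by all the phi_i, gives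
    [slope_sum_form]. The slopes 1, 1, 0, 0, 0, 1 show that this open condition
    can be met over every field. *)

(** * Multihomogeneous polynomials *)

(** Multihomogeneity with its degrees made explicit, since sums and products
    preserve it only with control on them. *)
Definition multidegree (K : fieldType) (n : nat) (f : {mpoly K[n * 3]})
    (d : 'I_n -> nat) : Prop :=
  forall m, m \in msupp f ->
    forall i, (\sum_(j < 3) m (mxvec_index i j))%N = d i.

Lemma multidegree_eq (K : fieldType) n (f : {mpoly K[n * 3]}) d d' :
  d =1 d' -> multidegree f d -> multidegree f d'.
Proof. by move=> dd' hf m mf i; rewrite (hf m mf) dd'. Qed.

Lemma multidegree0 (K : fieldType) n d :
  multidegree (0 : {mpoly K[n * 3]}) d.
Proof. by move=> m; rewrite msupp0. Qed.

Lemma multidegree1 (K : fieldType) n :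
  multidegree (1 : {mpoly K[n * 3]}) (fun=> 0%N).
Proof.
move=> m; rewrite msupp1 inE => /eqP -> i.
by rewrite big1 // => j _; rewrite mnm0E.
Qed.

Lemma multidegreeD (K : fieldType) n (f g : {mpoly K[n * 3]}) d :
  multidegree f d -> multidegree g d -> multidegree (f + g) d.
Proof.
by move=> hf hg m /msuppD_le; rewrite mem_cat => /orP[/hf | /hg].
Qed.

Lemma multidegreeZ (K : fieldType) n (f : {mpoly K[n * 3]}) c d :
  multidegree f d -> multidegree (c *: f) d.
Proof. by move=> hf m /msuppZ_le /hf. Qed.

Lemma multidegreeM (K : fieldType) n (f g : {mpoly K[n * 3]}) d e :
  multidegree f d -> multidegree g e ->
  multidegree (f * g) (fun i => (d i + e i)%N).
Proof.
move=> hf hg _ /msuppM_le /allpairsP[[m1 m2] /= [/hf h1 /hg h2 ->]] i.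
by rewrite -h1 -h2 -big_split; apply: eq_bigr => j _; rewrite mnmDE.
Qed.

Lemma multidegree_sum (K : fieldType) n (I : finType) (P : pred I)
    (F : I -> {mpoly K[n * 3]}) d :
  (forall k, P k -> multidegree (F k) d) ->
  multidegree (\sum_(k | P k) F k) d.
Proof.
move=> hF; apply: (big_ind (fun f => multidegree f d)) => //.
- exact: multidegree0.
- by move=> *; apply: multidegreeD.
Qed.

Definition block_form (K : fieldType) n (i : 'I_n) (phi : {scalar 'rV[K]_3}) :
  {mpoly K[n * 3]} := \sum_(j < 3) phi 'e_j *: 'X_(mxvec_index i j).

Lemma mxvec_index_eq m n (i i' : 'I_m) (j j' : 'I_n) :
  (mxvec_index i j == mxvec_index i' j') = (i == i') && (j == j').
Proof.
apply/eqP/andP => [|[/eqP-> /eqP->]//] e.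
have [f can_f _] := curry_mxvec_bij m n.
have := can_f (i, j) isT; have := can_f (i', j') isT.
by rewrite /= -e => -> [-> ->].
Qed.

Lemma block_form_multidegree (K : fieldType) n (i : 'I_n)
    (phi : {scalar 'rV[K]_3}) :
  multidegree (block_form i phi) (fun k => (k == i) : nat).
Proof.
apply: multidegree_sum => j _; apply: multidegreeZ => m.
rewrite msuppX inE => /eqP -> k.
under eq_bigr => l _ do rewrite mnm1E mxvec_index_eq.
rewrite (bigD1 j) //= eqxx andbT eq_sym big1 ?addn0 // => l /negPf.
by rewrite [j == l]eq_sym => ->; rewrite andbF.
Qed.

Arguments block_form_multidegree {K n} i phi.

Lemma meval_block_form (K : fieldType) n (i : 'I_n) (phi : {scalar 'rV[K]_3})
    (v : 'M[K]_(n, 3)) :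
  (block_form i phi).@[mxvec v 0] = phi (row i v).
Proof.
rewrite raddf_sum [in RHS](row_sum_delta (row i v)) raddf_sum.
by apply: eq_bigr => j _; rewrite /= mevalZ mevalXU mxvecE linearZ mxE mulrC.
Qed.

(** The product of the phi_i, times the sum of the s_k psi / phi_k with its
    denominators cleared: its nonvanishing expresses at once that the quotients
    are defined and that their signed sum is nonzero. *)
Definition slope_sum_form (K : fieldType) n (phi : 'I_n -> {scalar 'rV[K]_3})
    (psi : {scalar 'rV[K]_3}) (s : 'I_n -> K) : {mpoly K[n * 3]} :=
  (\prod_i block_form i (phi i)) *
  \sum_k s k *: (block_form k psi * \prod_(i | i != k) block_form i (phi i)).

Lemma prod_block_form_multidegree (K : fieldType) n
    (phi : 'I_n -> {scalar 'rV[K]_3}) (P : pred 'I_n) :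
  multidegree (\prod_(i | P i) block_form i (phi i)) P.
Proof.
have deg_seq : forall r : seq 'I_n,
    multidegree (\prod_(i <- r | P i) block_form i (phi i))
      (fun k => \sum_(i <- r | P i) (k == i))%N.
  elim=> [|i r IHr].
    rewrite big_nil; apply: multidegree_eq (@multidegree1 K n) => k.
    by rewrite big_nil.
  rewrite big_cons; case Pi: (P i).
    have deg_cons := multidegreeM (block_form_multidegree i (phi i)) IHr.
    by apply: multidegree_eq deg_cons => k; rewrite big_cons Pi.
  by apply: multidegree_eq IHr => k; rewrite big_cons Pi.
apply: multidegree_eq (deg_seq _) => k; rewrite big_mkcond (bigD1 k) //= eqxx.
rewrite big1 ?addn0 => [|i /negPf]; first by case: (P k).
by rewrite eq_sym => ->; case: (P i).
Qed.

Arguments prod_block_form_multidegree {K n} phi P.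

Lemma slope_sum_form_multihomogeneous (K : fieldType) n
    (phi : 'I_n -> {scalar 'rV[K]_3}) psi (s : 'I_n -> K) :
  multihomogeneous (slope_sum_form phi psi s).
Proof.
exists (fun i => (xpredT i + 1)%N).
apply: multidegreeM (prod_block_form_multidegree _ _) _.
apply: multidegree_sum => k _; apply: multidegreeZ.
have h := multidegreeM (block_form_multidegree k psi)
  (prod_block_form_multidegree phi (predC1 k)).
by apply: multidegree_eq h => i /=; case: (i == k).
Qed.

Lemma sum_prod_skip (K : fieldType) (I : finType) (s y z : I -> K) :
  (forall i, z i != 0) ->
  \sum_k s k * (y k * \prod_(i | i != k) z i) =
  (\prod_i z i) * \sum_k s k * (y k / z k).
Proof.
move=> nz; rewrite mulr_sumr; apply: eq_bigr => k _.
by rewrite [in RHS](bigD1 k) //=; field.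
Qed.

Lemma slope_sum_form_neq0 (K : fieldType) n
    (phi : 'I_n -> {scalar 'rV[K]_3}) (psi : {scalar 'rV[K]_3}) (s : 'I_n -> K)
    (v : 'M[K]_(n, 3)) :
  reflect ((forall i, phi i (row i v) != 0) /\
           \sum_k s k * (psi (row k v) / phi k (row k v)) != 0)
          ((slope_sum_form phi psi s).@[mxvec v 0] != 0).
Proof.
have eval_prod (P : pred 'I_n) :
    (\prod_(i | P i) block_form i (phi i)).@[mxvec v 0] =
    \prod_(i | P i) phi i (row i v).
  by rewrite rmorph_prod; apply: eq_bigr => i _; apply: meval_block_form.
have eval_sum :
    (\sum_k s k *: (block_form k psi *
       \prod_(i | i != k) block_form i (phi i))).@[mxvec v 0] =
    \sum_k s k * (psi (row k v) * \prod_(i | i != k) phi i (row i v)).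
  rewrite raddf_sum; apply: eq_bigr => k _; apply: etrans (mevalZ _ _ _) _.
  by rewrite mevalM meval_block_form eval_prod.
rewrite mevalM eval_prod eval_sum.
set p := \prod_i _.
have factor nz := sum_prod_skip s (fun k => psi (row k v))
  (z := fun i => phi i (row i v)) nz.
apply: (iffP idP).
  rewrite mulf_eq0 negb_or => /andP[/prodf_neq0 nz].
  have {}nz i : phi i (row i v) != 0 by apply: nz.
  by rewrite factor // mulf_eq0 negb_or => /andP[].
case=> nz sum_neq0; have p_neq0 : p != 0 by apply/prodf_neq0 => i _.
by rewrite factor // !mulf_neq0.
Qed.

(** * Points and lines spanned by vectors *)

Lemma free3P (K : fieldType) (V : vectType K) (u v w : V) :
  reflect (forall k l m, k *: u + l *: v + m *: w = 0 ->
             [/\ k = 0, l = 0 & m = 0])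
          (free [:: u; v; w]).
Proof.
apply: (iffP (@freeP _ _ 3 [tuple u; v; w])) => [h k l m e | h k].
  have := h (fun i => [:: k; l; m]`_i); rewrite !big_ord_recl big_ord0 /= addr0 addrA.
  by move=> /(_ e) h'; split; [have := h' 0|have := h' 1|have := h' 2%:R].
rewrite !big_ord_recl big_ord0 /= addr0 addrA => /h[k0 k1 k2].
case=> [[|[|[|//]]] Hi]; [rewrite -k0|rewrite -k1|rewrite -k2]; congr k; exact/val_inj.
Qed.

Lemma free3_rot (K : fieldType) (V : vectType K) (u v w : V) :
  free [:: u; v; w] = free [:: v; w; u].
Proof. by apply: perm_free; rewrite -(perm_rot 1). Qed.

Definition span_ppoint (K : fieldType) (v : 'rV[K]_3) (v0 : v != 0) : ppoint K.
Proof. by exists <[v]>%VS; rewrite dim_vline v0. Defined.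

Local Notation has_coords P w := (subspace_of_ppoint P = <[w%R]>%VS).

Lemma ppointP (K : fieldType) (p : ppoint K) : exists2 v, v != 0 & has_coords p v.
Proof.
have /eqP dp := valP p.
have p0 : vpick p != 0 by rewrite vpick0 -dimv_eq0 dp.
exists (vpick p) => //; apply/esym/eqP.
by rewrite eqEdim -memvE memv_pick dim_vline p0 dp.
Qed.

(** The third vector t serves to express the independence of p and q by the
    freeness of a triple, which determinants decide. *)
Lemma ppoint_neq (K : fieldType) (P Q : ppoint K) p q t :
  has_coords P p -> has_coords Q q ->
  free [:: p; q; t] -> P <> Q.
Proof.
move=> hP hQ; rewrite free_cons span_cons => /andP[+ _] ePQ; apply/negP/negPn.
by apply: subvP (addvSl _ _) _ _; rewrite -hQ -ePQ hP memv_line.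
Qed.

Lemma join_pline (K : fieldType) (P Q : ppoint K) :
  P <> Q -> exists l : pline K, (P + Q)%VS = l.
Proof.
move=> neqPQ; have [/eqP dP /eqP dQ] := (valP P, valP Q).
suff dPQ : \dim (P + Q) == 2%N by exists (Sub (P + Q)%VS dPQ : pline K).
have := dimv_sum_cap P Q; rewrite dP dQ => e.
suff : (\dim (P :&: Q) < 1)%N.
  by rewrite ltnS leqn0 => /eqP d0; move: e; rewrite d0 addn0 => ->.
rewrite -[X in (_ < X)%N]dP ltn_neqAle dimvS ?capvSl // andbT; apply/eqP => d.
apply: neqPQ; apply/val_inj/eqP => /=.
rewrite eqEdim dP dQ leqnn andbT; apply/capv_idPl/eqP.
by rewrite eqEdim capvSl d /=.
Qed.

Lemma line_throughI (K : fieldType) (P Q : ppoint K) (l : pline K) :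
  P <> Q -> (P <= l)%VS -> (Q <= l)%VS -> line_through P Q l.
Proof.
move=> nPQ Pl Ql; split=> //; have [m em] := join_pline nPQ.
apply/eqP; rewrite eqEdim subv_add Pl Ql em.
by rewrite (eqP (valP l)) (eqP (valP m)).
Qed.

(** Two distinct lines of the plane share at most one point; the vector t, on
    the first line but not on the second, witnesses that they are distinct. *)
Lemma meet_of_linesI (K : fieldType) (P Q R S X : ppoint K) p q r s x t u :
  has_coords P p -> has_coords Q q ->
  has_coords R r -> has_coords S s ->
  has_coords X x ->
  free [:: p; q; u] -> free [:: r; s; t] -> t \in (P + Q)%VS ->
  x \in (P + Q)%VS -> x \in (R + S)%VS -> meet_of_lines P Q R S X.
Proof.
move=> hP hQ hR hS hX fPQ fRS tPQ xPQ xRS.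
have [nPQ nRS] := (ppoint_neq hP hQ fPQ, ppoint_neq hR hS fRS).
have tRS : t \notin (R + S)%VS.
  move: fRS; rewrite -free3_rot free_cons !span_cons span_nil addv0 -hR -hS.
  by case/andP.
have [[l el] [m em]] := (join_pline nPQ, join_pline nRS).
rewrite el em in tPQ tRS xPQ xRS.
have /negP nlm : ~~ (l <= m)%VS by apply/subvPn; exists t.
exists l, m; split=> // [elm|]; first by rewrite elm subvv in nlm.
have [/eqP dl /eqP dX] := (valP l, valP X).
apply/esym/eqP; rewrite eqEdim subv_cap dX {1 2}hX -!memvE xPQ xRS /=.
rewrite -ltnS -[X in (_ < X)%N]dl ltn_neqAle dimvS ?capvSl // andbT.
apply/negP => d; apply/nlm/capv_idPl/eqP.
by rewrite eqEdim capvSl (eqP d) /=.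
Qed.

Lemma pline_join_point (K : fieldType) (C : ppoint K) (l : pline K) u :
  (C <= l)%VS -> u \in l -> u \notin C -> l = (<[u]> + C)%VS :> {vspace _}.
Proof.
move=> Cl ul uC; apply/esym/eqP.
rewrite eqEdim subv_add -memvE ul Cl (eqP (valP l)) /=.
rewrite -[X in (X < _)%N](eqP (valP C)) ltn_neqAle dimvS ?addvSr // andbT.
apply: contra uC => /eqP d; suff -> : subspace_of_ppoint C = (<[u]> + C)%VS.
  by apply: subvP (addvSl _ _) _ (memv_line u).
by apply/eqP; rewrite eqEdim addvSr -d /=.
Qed.

Lemma pline_eq (K : fieldType) (l m : pline K) : (l <= m)%VS -> l = m.
Proof.
by move=> lm; apply/val_inj/eqP; rewrite eqEdim lm (eqP (valP l)) (eqP (valP m)).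
Qed.

(** As K^3 is the sum of l and m, a vector d of n outside C splits as a + b with
    a in l and b in m. Neither a nor b is in C, for otherwise d would lie on m or
    on l respectively, and these lines meet n only in C. *)
Lemma concurrent_lines_frame (K : fieldType) (C : ppoint K) (l m n : pline K) :
  l <> m -> l <> n -> m <> n ->
  (C <= l)%VS -> (C <= m)%VS -> (C <= n)%VS ->
  exists a b c : 'rV[K]_3,
    [/\ free [:: a; b; c], has_coords C c,
        l = (<[a]> + <[c]>)%VS :> {vspace _},
        m = (<[b]> + <[c]>)%VS :> {vspace _}
      & n = (<[a + b]> + <[c]>)%VS :> {vspace _}].
Proof.
move=> nlm nln nmn Cl Cm Cn.
have [c c0 hC] := ppointP C.
have /subvPn[d dn dC] : ~~ (n <= C)%VS.
  by apply/negP => /dimvS; rewrite (eqP (valP n)) (eqP (valP C)).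
have full : (l + m)%VS = fullv.
  have dim3 : \dim {:'rV[K]_3} = 3%N by rewrite dimvf dim_matrix.
  apply/eqP; rewrite eqEdim subvf dim3.
  rewrite -[X in (X < _)%N](eqP (valP l)) ltn_neqAle dimvS ?addvSl // andbT.
  apply/negP => /eqP dl; apply/nlm/esym/pline_eq.
  suff -> : subspace_of_pline l = (l + m)%VS by rewrite addvSr.
  by apply/eqP; rewrite eqEdim addvSl -dl /=.
have /memv_addP[a al [b bm dab]] : d \in (l + m)%VS by rewrite full memvf.
have dl : d \notin l.
  apply/negP => dl; apply/nln/esym/pline_eq.
  by rewrite (pline_join_point Cn dn dC) subv_add -memvE dl.
have dm : d \notin m.
  apply/negP => dm; apply/nmn/esym/pline_eq.
  by rewrite (pline_join_point Cn dn dC) subv_add -memvE dm.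
have aC : a \notin C.
  by apply: contra dm => /(subvP Cm) am; rewrite dab memvD.
have bC : b \notin C.
  by apply: contra dl => /(subvP Cl) bl; rewrite dab memvD.
have [hl hm hn] := And3 (pline_join_point Cl al aC)
  (pline_join_point Cm bm bC) (pline_join_point Cn dn dC).
exists a, b, c; rewrite -dab -hC; split=> //.
rewrite !free_cons !span_cons span_nil addv0 -hC -hm bC /= nil_free.
rewrite andbT memv0 c0 andbT.
by apply: contra dm => am; rewrite dab memvD.
Qed.

(** * The configuration in coordinates *)

Definition comb (K : fieldType) (a b c : 'rV[K]_3) (x y z : K) :=
  x *: a + y *: b + z *: c.

Lemma comb_lin (K : fieldType) (a b c : 'rV[K]_3) k l x y z x' y' z' :
  k *: comb a b c x y z + l *: comb a b c x' y' z' =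
  comb a b c (k * x + l * x') (k * y + l * y') (k * z + l * z').
Proof.
rewrite /comb !scalerDr !scalerA !scalerDl.
by rewrite addrACA; congr (_ + _); rewrite addrACA.
Qed.

(** Cramer's rule: multiplying a vanishing combination by the cofactors of the
    coordinates isolates each coefficient times the determinant d. *)
Lemma comb_free (K : fieldType) (a b c : 'rV[K]_3) d
    x y z x' y' z' x'' y'' z'' :
  free [:: a; b; c] -> d != 0 ->
  x * (y' * z'' - y'' * z') - y * (x' * z'' - x'' * z')
    + z * (x' * y'' - x'' * y') = d ->
  free [:: comb a b c x y z; comb a b c x' y' z'; comb a b c x'' y'' z''].
Proof.
move=> /free3P fabc d0 hd; apply/free3P => k l m.
rewrite comb_lin -[comb a b c (k * x + _) _ _]scale1r comb_lin !mul1r.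
case/fabc => e1 e2 e3.
have cancel s : s * d = 0 -> s = 0.
  by move/eqP; rewrite mulf_eq0 (negPf d0) orbF => /eqP.
split; apply: cancel; rewrite -hd.
- transitivity ((y' * z'' - y'' * z') * (k * x + l * x' + m * x'')
    + (x'' * z' - x' * z'') * (k * y + l * y' + m * y'')
    + (x' * y'' - x'' * y') * (k * z + l * z' + m * z'')); first by ring.
  by rewrite e1 e2 e3 !mulr0 !addr0.
- transitivity ((y'' * z - y * z'') * (k * x + l * x' + m * x'')
    + (x * z'' - x'' * z) * (k * y + l * y' + m * y'')
    + (x'' * y - x * y'') * (k * z + l * z' + m * z'')); first by ring.
  by rewrite e1 e2 e3 !mulr0 !addr0.
- transitivity ((y * z' - y' * z) * (k * x + l * x' + m * x'')
    + (x' * z - x * z') * (k * y + l * y' + m * y'')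
    + (x * y' - x' * y) * (k * z + l * z' + m * z'')); first by ring.
  by rewrite e1 e2 e3 !mulr0 !addr0.
Qed.

Lemma mem_join (K : fieldType) (P Q : ppoint K) (p q v : 'rV[K]_3) k l :
  has_coords P p -> has_coords Q q ->
  v = k *: p + l *: q -> v \in (P + Q)%VS.
Proof.
by move=> -> -> ->; apply: memv_add; rewrite memvZ // memv_line.
Qed.

(** The vectors vA, vB, vA', vB' are the solutions of the linear systems that
    define the four intersection points, and vX = vA + vB' = vA' + vB spans the
    point of concurrency. The determinants of the triples used are, up to sign,
    1, p, s and p s. *)
Lemma hexagon_concurrent (K : fieldType) (a b c : 'rV[K]_3)
    (x1 x2 x3 x4 x5 x6 : K) (P1 P2 P3 P4 P5 P6 C : ppoint K) (l25 : pline K) :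
  let v := comb a b c in
  free [:: a; b; c] ->
  has_coords C (v 0 0 1) ->
  has_coords P1 (v 1 0 x1) -> has_coords P4 (v 1 0 x4) ->
  has_coords P2 (v 0 1 x2) -> has_coords P5 (v 0 1 x5) ->
  has_coords P3 (v 1 1 x3) -> has_coords P6 (v 1 1 x6) ->
  (P2 + P5)%VS = l25 ->
  x5 - x2 != 0 -> x1 + x2 - x3 + x4 + x5 - x6 != 0 ->
  exists A B A' B' : ppoint K, exists lAB' lA'B : pline K,
    [/\ meet_of_lines P1 P2 P5 P6 A, meet_of_lines P2 P3 P4 P5 B,
        meet_of_lines A C P3 P4 A' & meet_of_lines B C P1 P6 B'] /\
    [/\ line_through A B' lAB', line_through A' B lA'B
      & concurrent lAB' lA'B l25].
Proof.
move=> v fabc hC h1 h4 h2 h5 h3 h6 hl.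
set p := x5 - x2; set s := _ - x6 => p0 s0.
have vfree := comb_free fabc.
pose q := x1 + x5 - x6; pose q' := x4 + x2 - x3.
pose vA := v p q (p * x1 + q * x2).
pose vB := v (- p) q' (q' * x5 - p * x4).
pose vA' := v p q (q * x3 + (p - q) * x4).
pose vB' := v (- p) q' (q' * x6 - (p + q') * x1).
pose vX := v 0 (q + q') (q * x2 + q' * (x6 - x1)).
have point_of w w' w'' : free [:: w; w'; w''] ->
    exists W : ppoint K, has_coords W w.
  by move=> /free_not0 fw; exists (span_ppoint (fw w (mem_head _ _))).
have frA : free [:: vA; v 0 0 1; v 0 1 0].
  by apply: (vfree (- p)); rewrite ?oppr_eq0 // /q; ring.
have frB : free [:: vB; v 0 0 1; v 0 1 0].
  by apply: (vfree p) => //; ring.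
have frA' : free [:: vA'; v 0 0 1; v 0 1 0].
  by apply: (vfree (- p)); rewrite ?oppr_eq0 //; ring.
have frB' : free [:: vB'; v 0 0 1; v 0 1 0].
  by apply: (vfree p) => //; ring.
have frX : free [:: vX; v 1 0 0; v 0 0 1].
  by apply: (vfree (- s)); rewrite ?oppr_eq0 // /s /q /q'; ring.
have [A hA] := point_of _ _ _ frA; have [B hB] := point_of _ _ _ frB.
have [A' hA'] := point_of _ _ _ frA'; have [B' hB'] := point_of _ _ _ frB'.
have [X hX] := point_of _ _ _ frX.
have frAB' : free [:: vA; vB'; v 0 0 1].
  apply: (vfree (p * s)); first by rewrite mulf_neq0.
  by rewrite /s /q /q'; ring.
have frA'B : free [:: vA'; vB; v 0 0 1].
  apply: (vfree (p * s)); first by rewrite mulf_neq0.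
  by rewrite /s /q /q'; ring.
have [nAB' nA'B] := (ppoint_neq hA hB' frAB', ppoint_neq hA' hB frA'B).
have [[lAB' eAB'] [lA'B eA'B]] := (join_pline nAB', join_pline nA'B).
exists A, B, A', B', lAB', lA'B; split; split.
(* In the first two cases P2 is the point of one line that is off the other,
   because P2 <> P5; in the last two it is C. *)
- apply: (@meet_of_linesI _ _ _ _ _ _ _ _ _ _ _ (v 0 1 x2) (v 0 0 1)
            h1 h2 h5 h6 hA).
  + by apply: (vfree 1); rewrite ?oner_neq0 //; ring.
  + by apply: (vfree p) => //; rewrite /p; ring.
  + by rewrite h2 (subvP (addvSr _ _)) // memv_line.
  + apply: (mem_join (k := p) (l := q) h1 h2); rewrite comb_lin.
    by congr comb; ring.
  + apply: (mem_join (k := x1 + x2 - x6) (l := p) h5 h6); rewrite comb_lin.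
    by congr comb; rewrite /q /p; ring.
- apply: (@meet_of_linesI _ _ _ _ _ _ _ _ _ _ _ (v 0 1 x2) (v 0 0 1)
            h2 h3 h4 h5 hB).
  + by apply: (vfree (-1)); rewrite ?oppr_eq0 ?oner_neq0 //; ring.
  + by apply: (vfree (- p)); rewrite ?oppr_eq0 // /p; ring.
  + by rewrite h2 (subvP (addvSl _ _)) // memv_line.
  + apply: (mem_join (k := x4 + x5 - x3) (l := - p) h2 h3); rewrite comb_lin.
    by congr comb; rewrite /q' /p; ring.
  + apply: (mem_join (k := - p) (l := q') h4 h5); rewrite comb_lin.
    by congr comb; ring.
- apply: (@meet_of_linesI _ _ _ _ _ _ _ _ _ _ _ (v 0 0 1) (v 0 1 0)
            hA hC h3 h4 hA' frA).
  + by apply: (vfree (- 1)); rewrite ?oppr_eq0 ?oner_neq0 //; ring.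
  + by rewrite hC (subvP (addvSr _ _)) // memv_line.
  + apply: (mem_join (k := 1)
      (l := q * x3 + (p - q) * x4 - (p * x1 + q * x2)) hA hC).
    by rewrite comb_lin; congr comb; ring.
  + apply: (mem_join (k := q) (l := p - q) h3 h4); rewrite comb_lin.
    by congr comb; ring.
- apply: (@meet_of_linesI _ _ _ _ _ _ _ _ _ _ _ (v 0 0 1) (v 0 1 0)
            hB hC h1 h6 hB' frB).
  + by apply: (vfree 1); rewrite ?oner_neq0 //; ring.
  + by rewrite hC (subvP (addvSr _ _)) // memv_line.
  + apply: (mem_join (k := 1)
      (l := q' * x6 - (p + q') * x1 - (q' * x5 - p * x4)) hB hC).
    by rewrite comb_lin; congr comb; ring.
  + apply: (mem_join (k := - p - q') (l := q') h1 h6); rewrite comb_lin.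
    by congr comb; ring.
- by split.
- by split.
exists X; rewrite hX -!memvE -eAB' -eA'B -hl; split.
- apply: (mem_join (k := 1) (l := 1) hA hB'); rewrite comb_lin.
  by congr comb; ring.
- apply: (mem_join (k := 1) (l := 1) hA' hB); rewrite comb_lin.
  by congr comb; rewrite /q /q' /p; ring.
- (* vX has b-component q + q', which with its c-component determines l. *)
  pose l := q' * (x6 - x1 - x2) / p.
  apply: (mem_join (k := q + q' - l) (l := l) h2 h5); rewrite comb_lin /l.
  by congr comb; rewrite /q /q' ?/p; field.
Qed.

Lemma dual_frame (K : fieldType) (a b c : 'rV[K]_3) :
  free [:: a; b; c] ->
  exists alpha beta gamma : {scalar 'rV[K]_3},
    forall x y z, [/\ alpha (comb a b c x y z) = x,
      beta (comb a b c x y z) = y & gamma (comb a b c x y z) = z].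
Proof.
move=> fX; pose X := [tuple a; b; c].
have crd i x y z : coord X i (comb a b c x y z) = [:: x; y; z]`_i.
  have -> : comb a b c x y z = \sum_(j < 3) [:: x; y; z]`_j *: X`_j.
    by rewrite !big_ord_recl big_ord0 /= addr0 addrA.
  by rewrite (coord_sum_free (X := X)).
exists (coord X 0), (coord X 1), (coord X 2%:R) => x y z.
by split; apply: etrans (crd _ _ _ _) _.
Qed.

(** Reads off the slope of a point of the line <e a + f b, c> other than C from
    any homogeneous coordinates of it. *)
Lemma span_normalize (K : fieldType) (a b c w : 'rV[K]_3) e f
    (phi gamma : {scalar 'rV[K]_3}) :
  (forall z, phi (comb a b c e f z) = 1 /\ gamma (comb a b c e f z) = z) ->
  w \in (<[(e *: a + f *: b)%R]> + <[c]>)%VS -> phi w != 0 ->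
  <[w]>%VS = <[comb a b c e f (gamma w / phi w)]>%VS.
Proof.
move=> dual /memv_addP[_ /vlineP[k ->] [_ /vlineP[l ->] ew]].
have combE z : comb a b c e f z = (e *: a + f *: b) + z *: c by [].
move: (e *: a + f *: b) combE ew => u combE ew.
have {}dual z : phi (u + z *: c) = 1 /\ gamma (u + z *: c) = z.
  by rewrite -combE.
have lin (h : {scalar 'rV[K]_3}) k' v l' w' :
  h (k' *: v + l' *: w') = k' * h v + l' * h w'.
  by rewrite linearP linearZ.
have := dual 0; rewrite scale0r addr0 => -[phi_u gamma_u].
have := dual 1; rewrite -[u](scale1r u) !lin phi_u gamma_u !mul1r.
rewrite add0r => -[phi_c gamma_c].
have {}phi_c : phi c = 0 by apply: (addrI 1); rewrite addr0.
have phi_w : phi w = k by rewrite ew lin phi_u phi_c; ring.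
have gamma_w : gamma w = l by rewrite ew lin gamma_u gamma_c; ring.
rewrite combE phi_w gamma_w => k0.
have -> : w = k *: (u + (l / k) *: c).
  by rewrite ew scalerDr scalerA mulrCA divff ?mulr1.
apply/eqP; rewrite eqEsubv -!memvE memvZ ?memv_line //=.
by apply/vlineP; exists k^-1; rewrite scalerA mulVf ?scale1r.
Qed.

Lemma ord6_ind (Q : 'I_6 -> Prop) :
  Q 0 -> Q 1 -> Q 2 -> Q 3 -> Q 4 -> Q 5 -> forall i, Q i.
Proof.
move=> Q0 Q1 Q2 Q3 Q4 Q5 [[|[|[|[|[|[|//]]]]]] Hi];
  [move: Q0|move: Q1|move: Q2|move: Q3|move: Q4|move: Q5];
  by congr Q; apply: val_inj.
Qed.

Lemma sum_ord6 (V : nmodType) (F : 'I_6 -> V) :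
  \sum_i F i = F 0 + F 1 + F 2 + F 3 + F 4 + F 5.
Proof.
rewrite !big_ord_recl big_ord0 addr0 !addrA.
by do ?congr (_ + _); congr F; apply: val_inj.
Qed.

Theorem theorem7p15 (R : realType) (K : fieldType)
  (hK : K = (R : fieldType) \/ K = (R[i] : fieldType))
  (l14 l25 l36 : pline K) (C : ppoint K)
  (hl : [/\ l14 <> l25, l14 <> l36 & l25 <> l36])
  (hC : [/\ (C <= l14)%VS, (C <= l25)%VS & (C <= l36)%VS]) :
  generically
    (fun P : 'I_6 -> ppoint K =>
       let P1 := P 0 in let P2 := P 1 in let P3 := P 2 in
       let P4 := P 3 in let P5 := P 4 in let P6 := P 5 in
       [/\ line_through P1 P4 l14, line_through P2 P5 l25
         & line_through P3 P6 l36])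
    (fun P : 'I_6 -> ppoint K =>
       let P1 := P 0 in let P2 := P 1 in let P3 := P 2 in
       let P4 := P 3 in let P5 := P 4 in let P6 := P 5 in
       exists A B A' B' : ppoint K, exists lAB' lA'B : pline K,
         [/\ meet_of_lines P1 P2 P5 P6 A,
             meet_of_lines P2 P3 P4 P5 B,
             meet_of_lines A C P3 P4 A'
           & meet_of_lines B C P1 P6 B'] /\
         [/\ line_through A B' lAB',
             line_through A' B lA'B
           & concurrent lAB' lA'B l25]).
Proof.
have [nl1425 nl1436 nl2536] := hl; have [C14 C25 C36] := hC.
have [a [b [c [fabc hCc e14 e25 e36]]]] :=
  concurrent_lines_frame nl1425 nl1436 nl2536 C14 C25 C36.
have [alpha [beta [gamma dual]]] := dual_frame fabc.
(* The line of P_i is spanned by c and e_i a + f_i b, whose coefficients are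
   0 or 1, and alpha reads the coefficient of a + b on the third line. *)
pose e (i : 'I_6) : K := [:: 1; 0; 1; 1; 0; 1]`_i.
pose f (i : 'I_6) : K := [:: 0; 1; 1; 0; 1; 1]`_i.
pose pt i := comb a b c (e i) (f i).
pose phi (i : 'I_6) := nth alpha [:: alpha; beta; alpha; alpha; beta; alpha] i.
(* The signs of the slopes in q + q'. *)
pose s (i : 'I_6) : K := [:: 1; 1; -1; 1; 1; -1]`_i.
pose line (i : 'I_6) := nth l14 [:: l14; l25; l36; l14; l25; l36] i.
have dual_pt i z : phi i (pt i z) = 1 /\ gamma (pt i z) = z.
  rewrite /phi /pt; have [ha hb hc] := dual (e i) (f i) z; split=> //.
  by case: i ha hb hc => [[|[|[|[|[|[|//]]]]]] Hi] /=.
have line_pt i : line i = (<[(e i *: a + f i *: b)%R]> + <[c]>)%VS :> {vspace _}.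
  rewrite /line /e /f; case: i => [[|[|[|[|[|[|//]]]]]] Hi] /=;
  by rewrite !scale1r ?scale0r ?addr0 ?add0r.
pose form := slope_sum_form phi gamma s.
exists (fun P => exists f v, [/\ form = f, hcoords P v & f.@[mxvec v 0] != 0]).
split.
- exists (fun f => form = f); split=> // _ <-.
  exact: slope_sum_form_multihomogeneous.
- (* Slopes which differ on each line and have signed sum 1. *)
  pose x (i : 'I_6) : K := [:: 1; 1; 0; 0; 0; 1]`_i.
  have pt_neq0 i : pt i (x i) != 0.
    apply/eqP => pt0; have [/eqP + _] := dual_pt i (x i).
    by rewrite pt0 linear0 eq_sym oner_eq0.
  pose P i := span_ppoint (pt_neq0 i).
  have Pline i : (P i <= line i)%VS.
    rewrite line_pt -memvE memv_add ?memv_line //.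
    by rewrite memvZ ?memv_line.
  exists P; split.
    split; apply: line_throughI.
    + apply: (@ppoint_neq _ _ _ _ _ (comb a b c 0 1 0)) => //.
      by apply: (comb_free fabc (oner_neq0 K)); rewrite /e /f /x /=; ring.
    + exact: (Pline 0).
    + exact: (Pline 3).
    + apply: (@ppoint_neq _ _ _ _ _ (comb a b c (-1) 0 0)) => //.
      by apply: (comb_free fabc (oner_neq0 K)); rewrite /e /f /x /=; ring.
    + exact: (Pline 1).
    + exact: (Pline 4).
    + apply: (@ppoint_neq _ _ _ _ _ (comb a b c 1 0 0)) => //.
      by apply: (comb_free fabc (oner_neq0 K)); rewrite /e /f /x /=; ring.
    + exact: (Pline 2).
    + exact: (Pline 5).
  exists form, (\matrix_i pt i (x i)); split=> //; first by move=> i; rewrite rowK.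
  apply/slope_sum_form_neq0; split=> [i|].
    by rewrite rowK (dual_pt i _).1 oner_neq0.
  under eq_bigr => i _ do rewrite rowK (dual_pt i _).1 (dual_pt i _).2 divr1.
  rewrite sum_ord6 /s /x /=.
  by rewrite [X in X != 0](_ : _ = 1) ?oner_neq0 //; ring.
move=> P [t14 t25 t36] [_ [v [<- hv /slope_sum_form_neq0[phi0 sum0]]]].
have on_line i : (P i <= line i)%VS.
  have below (Q Q' : ppoint K) (l : pline K) :
      line_through Q Q' l -> (Q <= l)%VS /\ (Q' <= l)%VS.
    by case=> _ <-; rewrite addvSl addvSr.
  have [[P0 P3] [P1 P4] [P2 P5]] := And3 (below _ _ _ t14) (below _ _ _ t25)
    (below _ _ _ t36).
  by move: i; apply: ord6_ind.
pose x i := gamma (row i v) / phi i (row i v).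
have hP i : has_coords (P i) (pt i (x i)).
  rewrite -hv; apply: span_normalize (phi0 i) => [z|]; first exact: dual_pt.
  by rewrite -line_pt memvE hv.
apply: (@hexagon_concurrent _ a b c (x 0) (x 1) (x 2) (x 3) (x 4) (x 5)) => //.
- by rewrite /comb !scale0r !add0r scale1r.
- by case: t25.
- rewrite subr_eq0; apply/negP => /eqP x41; case: t25 => /eqP/negP[].
  by rewrite -val_eqE; apply/eqP; rewrite [LHS](hP 1) [RHS](hP 4) {1}/pt /= x41.
- suff <- : \sum_k s k * x k = x 0 + x 1 - x 2 + x 3 + x 4 - x 5 by [].
  by rewrite sum_ord6 /s /=; ring.
Qed.
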